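(* Let $m\ge 3$ and $n\ge 2$. For every positive integer $k$, $$\chi_{B_1^*(m,n)}(2k+1)=\Big[\sum_{i=0}^{m-3}(-1)^i(2k)^{(m-2)-i}\Big]\,\chi_{B_1^*(m,n-1)}(2k+1)+(-1)^{m-2}\chi_{B_m^{n-1}}(2k+1).$$
   Context: A signed graph $(G,\sigma)$ is a finite graph $G$ (parallel edges allowed) with a sign function $\sigma:E(G)\to\{+1,-1\}$; its signature is the set of negative edges. A signed coloring in $2k+1$ colors is a map $c:V(G)\to\{-k,\dots,k\}$; it is proper if $c(y)\neq\sigma(e)c(x)$ for every edge $e=xy$. The signed chromatic polynomial $\chi_{(G,\sigma)}(2k+1)$ is the number of proper signed colorings in $2k+1$ colors. For integers $m\ge 3$, $n\ge 1$, the Book graph $B(m,n)$ has vertex set $\{u,v\}\cup\{u_j^l:1\le l\le n,\,1\le j\le m-2\}$ and consists of the $n$ cycles $u\,u_1^l\cdots u_{m-2}^l\,v\,u$ sharing the edge $uv$. For $1\le l\le n$, $B_l^*(m,n)$ denotes $B(m,n)$ with signature $\{uv,uu_1^1,\dots,uu_1^{l-1}\}$; in particular $B_1^*(m,n)$ has signature $\{uv\}$. The signed graph $B_m^n$ is obtained from $B(m,n)$ with all edges positive by replacing the edge $uv$ with two parallel edges between $u$ and $v$, one positive and one negative. *)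

(* Defs.v *)
From mathcomp Require Import all_boot all_order all_algebra.
Set Implicit Arguments.
Unset Strict Implicit.
Unset Printing Implicit Defensive.
Import Order.TTheory GRing.Theory Num.Theory.

(* Finite multigraphs. Edges are unoriented: the order of the two components
   of [ends e] is an artefact of the encoding (see [edge_okC] below). *)
Record multigraph := Multigraph {
  vertex : finType;
  edge : finType;
  ends : edge -> vertex * vertex
}.

(* A sign function E -> {+1, -1} is given by its set of negative edges. *)
Record signed_graph := SignedGraph {
  graph_of :> multigraph;
  signature : {set edge graph_of}
}.

Definition sigma (G : signed_graph) (e : edge G) : int :=
  if e \in signature G then (-1)%R else 1%R.

(* The ordinal i < 2k+1 stands for the color i - k of {-k, ..., k}. *)
Definition color (k : nat) := 'I_(2 * k + 1).

Definition color_val (k : nat) (i : color k) : int := (i%:Z - k%:Z)%R.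

Definition edge_ok (k : nat) (s : int) (a b : color k) : bool :=
  color_val b != (s * color_val a)%R.

Definition proper (G : signed_graph) (k : nat)
    (c : {ffun vertex G -> color k}) : bool :=
  [forall e : edge G, edge_ok (sigma e) (c (ends e).1) (c (ends e).2)].

(* [schi G k] is the value at 2k+1 of the signed chromatic polynomial of G. *)
Definition schi (G : signed_graph) (k : nat) : nat :=
  #|[set c : {ffun vertex G -> color k} | proper c]|.

Lemma edge_okC (G : signed_graph) (k : nat) (e : edge G) (a b : color k) :
  edge_ok (sigma e) a b = edge_ok (sigma e) b a.
Proof.
rewrite /edge_ok /sigma; case: ifP => _; last by rewrite !mul1r eq_sym.
by rewrite !mulN1r eq_sym eqr_oppLR.
Qed.

Definition book_vertex (m n : nat) : finType :=
  (bool + 'I_n * 'I_(m - 2))%type.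

Definition book_u (m n : nat) : book_vertex m n := inl false.
Definition book_v (m n : nat) : book_vertex m n := inl true.
(* [book_page l j] is the vertex u_(j+1)^(l+1). *)
Definition book_page (m n : nat) (l : 'I_n) (j : 'I_(m - 2)) :
  book_vertex m n := inr (l, j).

(* The i-th vertex (from 0) of the path u, u_1^(l+1), ..., u_(m-2)^(l+1), v. *)
Definition path_vertex (m n : nat) (l : 'I_n) (i : nat) : book_vertex m n :=
  match i with
  | 0 => book_u m n
  | i'.+1 => if insub i' is Some j then book_page l j else book_v m n
  end.

Lemma path_vertex_page (m n : nat) (l : 'I_n) (j : 'I_(m - 2)) :
  path_vertex m l j.+1 = book_page l j.
Proof. by rewrite /path_vertex valK. Qed.

Lemma path_vertex_last (m n : nat) (l : 'I_n) :
  2 < m -> path_vertex m l (m - 1) = book_v m n.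
Proof.
case: m => [|[|m]] // _.
by rewrite /path_vertex subn1 /= insubF // subn2 ltnn.
Qed.

(* [(l, i)] is the edge joining the i-th and (i+1)-st vertices of the path of
   page l; for i = 0 it is u u_1^(l+1). *)
Definition page_edge (m n : nat) : finType := ('I_n * 'I_(m - 1))%type.

Definition page_ends (m n : nat) (e : page_edge m n) :
    book_vertex m n * book_vertex m n :=
  (path_vertex m e.1 e.2, path_vertex m e.1 e.2.+1).

(* B(m,n); [None] is the edge uv. *)
Definition book (m n : nat) : multigraph :=
  @Multigraph (book_vertex m n) (option (page_edge m n))
    (fun e => if e is Some pe then page_ends pe else (book_u m n, book_v m n)).

(* B_l^*(m,n), whose signature is {uv, uu_1^1, ..., uu_1^(l-1)}. *)
Definition book_star (l m n : nat) : signed_graph :=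
  @SignedGraph (book m n)
    [set e : option (page_edge m n) |
      if e is Some pe then (pe.1.+1 < l) && (pe.2 == 0 :> nat) else true].

(* The graph underlying B_m^n: the edge uv of B(m,n) is replaced by the two
   parallel edges [inl false] and [inl true]. *)
Definition book_double_graph (m n : nat) : multigraph :=
  @Multigraph (book_vertex m n) (bool + page_edge m n)%type
    (fun e => if e is inr pe then page_ends pe else (book_u m n, book_v m n)).

(* B_m^n; [inl true] is its only negative edge. *)
Definition book_double (m n : nat) : signed_graph :=
  @SignedGraph (book_double_graph m n)
    [set (inl true : (bool + page_edge m n)%type)].

(* Main.v *)
Require Import Defs.
From mathcomp Require Import all_boot all_order all_algebra.
From mathcomp Require Import ring.
Import Order.TTheory GRing.Theory Num.Theory.
Local Open Scope ring_scope.

(** Once the colors a of u and b of v are fixed, the pages are colored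
    independently, so each signed chromatic polynomial is the sum, over the
    pairs (a, b) allowed by the uv edges, of the n-th power of the number W(a, b)
    of proper colorings of the interior of one page.  With S the bracketed sum
    of the theorem, W(a, b) = S + (-1)^(m-2) [a <> b]; splitting off one factor
    W(a, b) gives the recursion, since [a <> b] is exactly the constraint imposed
    by the additional positive edge of B_m^(n-1). *)

Section Walks.

Variable T : finType.

(** Follows the recursion of [path_vertex], so that a page of the book can be read as such a walk.
    The default [b] of the failing [insub] makes index [r.+1] the far endpoint. *)
Definition walk_vertex (r : nat) (a b : T) (f : {ffun 'I_r -> T}) (i : nat) : T :=
  if i is i'.+1 then (if insub i' is Some j then f j else b) else a.

Definition walk_ok (r : nat) (a b : T) (f : {ffun 'I_r -> T}) : bool :=
  [forall i : 'I_r.+1, walk_vertex r a b f i.+1 != walk_vertex r a b f i].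

(** Walks of length [r.+1] from [a] to [b] in the complete graph on [T]. *)
Definition walks (r : nat) (a b : T) : nat := #|[pred f | walk_ok r a b f]|.

Definition ffun_cons (r : nat) (p : T * {ffun 'I_r -> T}) : {ffun 'I_r.+1 -> T} :=
  [ffun j => if unlift ord0 j is Some j' then p.2 j' else p.1].

Definition ffun_uncons (r : nat) (f : {ffun 'I_r.+1 -> T}) : T * {ffun 'I_r -> T} :=
  (f ord0, [ffun j => f (lift ord0 j)]).

Lemma ffun_consK r : cancel (ffun_cons r) (ffun_uncons r).
Proof.
case=> x f; rewrite /ffun_uncons ffunE unlift_none; congr pair.
by apply/ffunP=> j; rewrite !ffunE liftK.
Qed.

Lemma ffun_unconsK r : cancel (ffun_uncons r) (ffun_cons r).
Proof.
move=> f; apply/ffunP=> j; rewrite ffunE.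
by case: unliftP => [j' ->|->] //=; rewrite ffunE.
Qed.

Lemma walk_vertex_cons r a b x f i :
  walk_vertex r.+1 a b (ffun_cons r (x, f)) i.+1 = walk_vertex r x b f i.
Proof.
case: i => [|i] /=.
  by rewrite insubT //= ffunE; case: unliftP => // j /(congr1 val).
case: (ltnP i r) => [lt_ir|le_ri]; last first.
  by rewrite !insubF // ?ltnS ltnNge le_ri.
rewrite !insubT // ffunE; case: unliftP => [j /(congr1 val)|/(congr1 val)] //=.
by rewrite /bump /= add1n => -[ij]; congr (f _); apply: val_inj.
Qed.

Lemma walk_ok_cons r a b x f :
  walk_ok r.+1 a b (ffun_cons r (x, f)) = (x != a) && walk_ok r x b f.
Proof.
apply/forallP/andP => [ok|[xa /forallP ok] i].
  split; first by have := ok ord0; rewrite walk_vertex_cons.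
  by apply/forallP=> i; have := ok (lift ord0 i); rewrite lift0 !walk_vertex_cons.
case: (unliftP ord0 i) => [j ->|->]; last by rewrite walk_vertex_cons.
by rewrite lift0 !walk_vertex_cons; apply: ok.
Qed.

Lemma walks0 a b : walks 0 a b = (b != a).
Proof.
rewrite /walks (eq_card (B := fun=> b != a)) => [|f].
  by case: (b != a); rewrite ?card0 // (eq_card1 (x := [ffun=> a])) // => f;
    apply/esym/eqP/ffunP; case.
rewrite !inE; apply/forallP/idP => [/(_ ord0)|ba [[|//] ?]] /=; by rewrite insubF.
Qed.

(** Classifies walks by the color [x] of their first interior vertex; [ffun_cons] is the bijection
    that splits it off. *)
Lemma walksS r a b : walks r.+1 a b = (\sum_(x | x != a) walks r x b)%N.
Proof.
rewrite /walks -sum1_card (reindex (ffun_cons r)) /=; last first.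
  by exists (ffun_uncons r) => f _; rewrite (ffun_consK, ffun_unconsK).
rewrite (eq_bigl (fun p => (p.1 != a) && walk_ok r p.1 b p.2)); last first.
  by case=> x f; rewrite inE walk_ok_cons.
rewrite -(pair_big_dep (fun x => x != a) (fun x f => walk_ok r x b f)
  (fun _ _ => 1%N)) /=.
by apply: eq_bigr => x _; rewrite -sum1_card.
Qed.

End Walks.

(** Induction on [r] through [walksS]: summing the formula over the [q] colors [x != a] multiplies
    its geometric part by [q], while the last term needs only the number of colors outside
    [{a, b}]. *)
Lemma walks_closed (T : finType) (q r : nat) (a b : T) : #|T| = q.+1 ->
  (walks T r a b)%:Z =
    \sum_(0 <= i < r) (-1) ^+ i * q%:Z ^+ (r - i)%N + (-1) ^+ r * (b != a)%:Z.
Proof.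
move=> cardT; elim: r a => [|r IH] a; first by rewrite walks0 big_nil add0r mul1r.
have card_neq (c : T) : (\sum_(x | x != c) 1 = q)%N.
  by rewrite sum1_card cardC1 cardT.
have card_neq2 : (\sum_(x : T | x != a) (b != x))%N%:Z = q%:Z - (b != a)%:Z.
  apply/eqP; rewrite eq_sym subr_eq -PoszD; apply/eqP; congr Posz.
  (* Among the [q] colors different from [b], the color [a] is counted separately and contributes
     [b != a]. *)
  rewrite -[LHS](card_neq b) big_mkcond (bigD1 a) //= addnC eq_sym.
  by congr (_ + _)%N; apply: eq_bigr => x _; rewrite eq_sym; case: eqP.
rewrite walksS; set S := \sum_(0 <= i < r) _ in IH.
(* Each old summand gains a factor [q]; the new one, [i = r], has exponent 1. *)
have -> : \sum_(0 <= i < r.+1) (-1) ^+ i * q%:Z ^+ (r.+1 - i)%N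
          = q%:Z * S + (-1) ^+ r * q%:Z.
  rewrite big_nat_recr //= subSnn; congr (_ + _); rewrite mulr_sumr.
  by apply: eq_big_nat => i /andP[_ /ltnW le_ir]; rewrite subSn // exprS mulrCA.
rewrite (big_morph Posz PoszD (erefl _)) (eq_bigr _ (fun x _ => IH x)).
rewrite big_split /= -mulr_sumr -(big_morph Posz PoszD (erefl _)) card_neq2.
rewrite (eq_bigr (fun=> S * 1%N%:Z)) => [|x _]; last by rewrite mulr1.
rewrite -mulr_sumr -(big_morph Posz PoszD (erefl _)) card_neq exprS; ring.
Qed.

Definition page (m n k : nat) (c : {ffun book_vertex m n -> color k}) (l : 'I_n) :
  {ffun 'I_(m - 2) -> color k} := [ffun j => c (book_page l j)].

Lemma path_vertex_walk m n k (c : {ffun book_vertex m n -> color k}) l i :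
  c (path_vertex m l i) =
  walk_vertex _ _ (c (book_u m n)) (c (book_v m n)) (page m n k c l) i.
Proof. by case: i => //= i; case: insubP => // j _ _; rewrite ffunE. Qed.

Lemma edge_ok1 k (a b : color k) : edge_ok 1 a b = (b != a).
Proof.
by rewrite /edge_ok mul1r /color_val (inj_eq (addIr _)) eqz_nat.
Qed.

Definition book_coloring (m n k : nat)
    (p : (color k * color k) * {ffun 'I_n -> {ffun 'I_(m - 2) -> color k}}) :
    {ffun book_vertex m n -> color k} :=
  [ffun x => match x with
             | inl s => if s then p.1.2 else p.1.1
             | inr lj => p.2 lj.1 lj.2
             end].

Lemma book_coloring_bij m n k : bijective (book_coloring m n k).
Proof.
exists (fun c : {ffun book_vertex m n -> color k} =>
  ((c (book_u m n), c (book_v m n)), [ffun l => page m n k c l])).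
  case=> [[a b] g]; rewrite !ffunE; congr pair; apply/ffunP=> l; rewrite ffunE.
  by apply/ffunP=> j; rewrite !ffunE.
by move=> c; apply/ffunP=> -[[]|[l j]]; rewrite !ffunE.
Qed.

(** [Q] stands for the constraint of the [uv] edges, so one count serves both graphs. For fixed end
    colors, the admissible families of pages are the functions from ['I_n] to the set of walks,
    whence the power. *)
Lemma card_book_colorings m n k (Q : rel (color k)) :
  #|[pred c : {ffun book_vertex m n -> color k} |
      Q (c (book_u m n)) (c (book_v m n)) &&
      [forall l, walk_ok _ _ (c (book_u m n)) (c (book_v m n)) (page m n k c l)]]|
  = (\sum_(p : color k * color k | Q p.1 p.2) walks _ (m - 2) p.1 p.2 ^ n)%N.
Proof.
rewrite -sum1_card (reindex (book_coloring m n k)) /=; last first.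
  exact/onW_bij/book_coloring_bij.
rewrite (eq_bigl (fun p : (color k * color k) * {ffun _ -> {ffun _ -> color k}} =>
  Q p.1.1 p.1.2 &&
  [forall l, walk_ok _ _ p.1.1 p.1.2 (p.2 l)])); last first.
  case=> [[a b] g]; rewrite inE /= !ffunE /=; congr (_ && _).
  apply: eq_forallb => l; congr walk_ok.
  by apply/ffunP=> j; rewrite !ffunE.
rewrite -(pair_big_dep (fun ab : color k * color k => Q ab.1 ab.2)
  (fun ab (g : {ffun _}) => [forall l, walk_ok _ _ ab.1 ab.2 (g l)])
  (fun _ _ => 1%N)) /=.
apply: eq_bigr => -[a b] _ /=; rewrite /walks -[n in RHS]card_ord -card_ffun_on.
by rewrite -sum1_card.
Qed.

Lemma page_edges_ok m n k (c : {ffun book_vertex m n -> color k}) : (2 < m)%N ->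
  [forall e : page_edge m n,
     edge_ok 1 (c (page_ends e).1) (c (page_ends e).2)] =
  [forall l, walk_ok _ _ (c (book_u m n)) (c (book_v m n)) (page m n k c l)].
Proof.
(* A page has [m - 1] edges but [m - 2] interior vertices; the cast matches its edges with the steps
   of the walk. *)
move=> hm; have em : (m - 1)%N = (m - 2).+1 by rewrite (subnSK (ltnW hm)).
apply/forallP/forallP => [ok l|ok [l i]].
  apply/forallP=> i; have := ok (l, cast_ord (esym em) i).
  by rewrite edge_ok1 !path_vertex_walk.
by have /forallP/(_ (cast_ord em i)) := ok l; rewrite edge_ok1 !path_vertex_walk.
Qed.

(** For [l = 1] the condition [pe.1.+1 < l] never holds, so [uv] is the only negative edge. *)
Lemma schi_book_star1 m n k : (2 < m)%N ->
  schi (book_star 1 m n) k =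
  (\sum_(p : color k * color k | edge_ok (-1) p.1 p.2)
      walks _ (m - 2) p.1 p.2 ^ n)%N.
Proof.
move=> hm; rewrite -card_book_colorings /schi cardsE; apply: eq_card => c.
rewrite !inE -page_edges_ok //; apply/forallP/andP => [ok|[ok0 /forallP ok] [e|]].
- split; first by have := ok None; rewrite /sigma inE.
  by apply/forallP=> e; have := ok (Some e); rewrite /sigma inE.
- by rewrite /sigma inE; apply: ok.
- by rewrite /sigma inE.
Qed.

Lemma schi_book_double m n k : (2 < m)%N ->
  schi (book_double m n) k =
  (\sum_(p : color k * color k | edge_ok (-1) p.1 p.2 && (p.2 != p.1))
      walks _ (m - 2) p.1 p.2 ^ n)%N.
Proof.
move=> hm; rewrite -(card_book_colorings _ _ _ (fun a b => edge_ok (-1) a b && (b != a))).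
rewrite /schi cardsE; apply: eq_card => c; rewrite !inE -page_edges_ok //.
apply/forallP/andP => [ok|[/andP[okN ok1] /forallP ok] [[]|e]].
- split; last by apply/forallP=> e; have := ok (inr e); rewrite /sigma inE.
  have := ok (inl true); have := ok (inl false).
  by rewrite /sigma !inE /= edge_ok1 => -> ->.
- by rewrite /sigma inE.
- by rewrite /sigma inE /= edge_ok1.
- by rewrite /sigma inE; apply: ok.
Qed.

Theorem theorem6p8 (m n k : nat) (hm : (3 <= m)%N) (hn : (2 <= n)%N)
    (hk : (0 < k)%N) :
  (schi (book_star 1 m n) k)%:Z =
    (\sum_(0 <= i < m - 2) (-1) ^+ i * (2 * k)%N%:Z ^+ ((m - 2) - i)%N)
      * (schi (book_star 1 m (n - 1)) k)%:Z
    + (-1) ^+ (m - 2)%N * (schi (book_double m (n - 1)) k)%:Z.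
Proof.
case: n hn => // n _; rewrite subn1 /= !schi_book_star1 // schi_book_double //.
(* The extra condition [b != a] moves into the summand, so that all three sums range over the same
   pairs and can be compared term by term. *)
rewrite !(big_morph Posz PoszD (erefl _)) [in X in _ + _ * X]big_mkcondr /=.
rewrite !mulr_sumr -big_split /=; apply: eq_bigr => -[a b] _ /=.
have cardC : #|color k| = (2 * k).+1 by rewrite card_ord addn1.
(* Only the factor split off is expanded; the remaining power stays opaque. *)
rewrite expnS PoszM (walks_closed _ _ _ _ _ cardC); case: (b != a) => /=; ring.
Qed.
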